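(* Let $X$ be a dyadic compactum such that $\pi\chi(p,X)=w(X)$ for all $p\in X$. Then every base $\mathcal{A}$ of $X$ contains a subset that is an $\omega^{\mathrm{op}}$-like base of $X$.
   Context: A dyadic compactum is a Hausdorff continuous image of $2^\kappa$ for some cardinal $\kappa$. $\pi\chi(p,X)$ is the $\pi$-character of $p$ and $w(X)$ the weight of $X$. Families of open sets are ordered by inclusion; a family is $\omega^{\mathrm{op}}$-like if each member is contained in only finitely many members. *)

(* Defs.v *)
From HB Require Import structures.
From mathcomp Require Import all_boot all_order.
From mathcomp Require Import all_classical all_reals all_analysis.
Set Implicit Arguments. Unset Strict Implicit. Unset Printing Implicit Defensive.
Local Open Scope classical_set_scope.
Local Open Scope card_scope.

Definition is_base (X : topologicalType) (B : set (set X)) : Prop :=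
  (forall V, B V -> open V) /\
  (forall (U : set X) (x : X), open U -> U x ->
     exists V, [/\ B V, V x & V `<=` U]).

Definition is_local_pi_base (X : topologicalType) (p : X) (P : set (set X)) : Prop :=
  (forall V, P V -> open V /\ V !=set0) /\
  (forall U : set X, open U -> U p -> exists V, P V /\ V `<=` U).

(* pi-character at p equals weight: since cardinals are well-ordered,
   min{|P| : P local pi-base at p} = min{|B| : B base} iff each local pi-base
   at p has cardinality >= some base and each base has cardinality >= some
   local pi-base at p. *)
Definition pichar_eq_weight (X : topologicalType) (p : X) : Prop :=
  (forall P, is_local_pi_base p P -> exists B : set (set X), is_base B /\ B #<= P) /\
  (forall B : set (set X), is_base B -> exists P, is_local_pi_base p P /\ P #<= B).

(* Dyadic compactum: Hausdorff continuous image of the Cantor cube 2^kappa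
   (product topology on K -> bool, bool discrete), for some index set K. *)
Definition dyadic_compactum (X : topologicalType) : Prop :=
  hausdorff_space X /\ compact [set: X] /\
  exists (K : Type) (f : {ptws K -> bool} -> X), continuous f /\ (forall x : X, exists k, f k = x).

Definition omega_op_like (X : Type) (A : set (set X)) : Prop :=
  forall U, A U -> finite_set [set V | A V /\ U `<=` V].

(* Main.v *)
Require Import Defs.
From mathcomp Require Import all_boot all_order.
From mathcomp Require Import all_classical all_reals all_analysis.
From mathcomp Require wochoice.
Local Open Scope classical_set_scope.
Local Open Scope card_scope.
Set Implicit Arguments. Unset Strict Implicit. Unset Printing Implicit Defensive.

(**
Let [f : 2^K -> X] be a continuous surjection and [B] a base of [X] of minimal
size [kappa].  Well-order in type [kappa] the pairs [(C, G)] from [B] with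
[closure C `<=` G].  At each stage cover [closure C] by finitely many members
[V `<=` G] of [A], and record a finite set of coordinates of [2^K] supporting a
clopen set between [f^-1 (closure V)] and the preimage of a slightly larger open
set [O].  Fewer than [kappa] coordinates have been recorded before, so the
nonempty interiors of the images of clopen sets supported by them do not form a
local pi-base at any point; hence [O] can be taken to contain none of them.

Let [U] be nonempty and open, and let [N] be nonempty and open with
[closure N `<=` U].  Some clopen set between [f^-1 (closure N)] and [f^-1 U] has
finite support [s].  If [U `<=` V] with [V] chosen at a stage [a], interpolate
between this clopen set and the one attached to [V] by a clopen set whose
support is the intersection of the two supports; its image contains [N], so by
the choice of [V] some coordinate in [s] is recorded for the first time at stage
[a].  So there are at most [#|s|] such stages, and [U] lies in finitely many
chosen sets.

To avoid cardinal arithmetic, sizes are measured by binary trees [code W] with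
leaves in an initial segment of a well-ordered type [W]: such trees absorb finite
sequences, and adding one point to the segment does not increase their number.
*)

(** * Compact Hausdorff spaces and the Cantor cube *)

Lemma compact_hausdorff_shrink (X : topologicalType) (x : X) (U : set X) :
  hausdorff_space X -> compact [set: X] -> open U -> U x ->
  exists N : set X, [/\ open N, N x & closure N `<=` U].
Proof.
move=> hX cX oU Ux.
have rx : {for x, regular_space X} by apply: (compact_regular hX cX); exact: filterT.
have [|N] := rx U; first exact: open_nbhs_nbhs.
move=> nN clN; exists N°; split; first exact: open_interior.
  exact: nN.
exact: subset_trans (closureS (@interior_subset _ N)) clN.
Qed.

(** Near-covering compactness is applied to the filter of finite sequences in [A] that eventually
    contain any given finite part of [A]. *)
Lemma compact_finite_subcover (T : topologicalType) (A : set T) (U : T -> set T) :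
  compact A -> (forall x, A x -> nbhs x (U x)) ->
  exists s : seq T, (forall x, x \in s -> A x) /\
    forall y, A y -> exists2 x, x \in s & U x y.
Proof.
move=> /compact_near_coveringP cA AU.
pose F : set_system (seq T) := filter_from [set s : seq T | forall x, x \in s -> A x]
  (fun s : seq T => [set s' : seq T | {subset s <= s'} /\ forall x, x \in s' -> A x]).
have FF : Filter F.
  apply: filter_from_filter; first by exists [::].
  move=> r s rA sA; exists (r ++ s).
    by move=> x; rewrite mem_cat => /orP[/rA|/sA].
  move=> q [rsq qA]; split; (split => //) => x xr; apply: rsq;
    by rewrite mem_cat xr ?orbT.
have [x Ax|s sA sP] := cA _ F (fun (s : seq T) y => exists2 x, x \in s & U x y) FF.
  exists (U x, [set s : seq T | x \in s]) => /=.
    split; first exact: AU.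
    exists [:: x] => [z|s [xs _]]; first by rewrite inE => /eqP->.
    by apply: xs; rewrite mem_head.
  by move=> [y s] [/= Uxy xs]; exists x.
by exists s; split => // y; apply: (sP s); split.
Qed.

Section CantorCube.
Variable K : choiceType.
Implicit Types (r s t : seq K) (D w : set (K -> bool)).

(** The least set supported by [r] that contains [D]. *)
Definition sat r D : set (K -> bool) := [set y | exists2 x, D x & {in r, x =1 y}].

Definition supported r w := forall x y, {in r, x =1 y} -> w x -> w y.

Lemma sat_supported r D : supported r (sat r D).
Proof. by move=> x y xy [z Dz zx]; exists z => // i ri; rewrite zx// xy. Qed.

Lemma sub_sat r D : D `<=` sat r D.
Proof. by move=> x Dx; exists x. Qed.

Lemma supportedS r s w : {subset r <= s} -> supported r w -> supported s w.
Proof. by move=> rs rw x y xy; apply: rw => i /rs; exact: xy. Qed.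

(** Glue [y] on [s] to [x] off [s]: the result [z] lies in [w] because it agrees with [y] on [s]. It
    agrees with [x] on [t] because [x] and [y] agree on the common part of [s] and [t]. *)
Lemma sat_interpolation s t r w w' :
  (forall i, i \in s -> i \in t -> i \in r) ->
  supported s w -> supported t w' -> w `<=` w' -> sat r w `<=` w'.
Proof.
move=> str sw tw' ww' x [y wy yx].
pose z i := if i \in s then y i else x i.
apply: (tw' z) => [i ti|].
  by rewrite /z; case: ifP => // si; apply: yx; exact: str.
by apply: ww'; apply: sw wy => i si; rewrite /z si.
Qed.

Lemma cube_open_cylinder (O : set {ptws K -> bool}) x : open O -> O x ->
  exists r, forall y : K -> bool, {in r, x =1 y} -> O y.
Proof.
move=> oO Ox.
pose F : set_system {ptws K -> bool} :=
  filter_from setT (fun r => [set y : K -> bool | {in r, x =1 y}]).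
have FF : Filter F.
  apply: filter_from_filter; first by exists [::].
  move=> r s _ _; exists (r ++ s) => // y xy.
  by split=> i ri; apply: xy; rewrite mem_cat ri ?orbT.
have Fx : F --> (x : {ptws K -> bool}).
  apply/cvg_sup => i V [W [[V' oV' <-] V'x] WV].
  exists [:: i] => // y xy; apply: WV => /=.
  by move: V'x; rewrite /= xy// mem_head.
have [r _ rO] := Fx O (open_nbhs_nbhs (conj oO Ox)).
by exists r.
Qed.

Lemma cylinder_open (z : K -> bool) r :
  open ([set y : K -> bool | {in r, z =1 y}] : set {ptws K -> bool}).
Proof.
elim: r => [|i r IHr].
  by rewrite (_ : [set y | _] = setT); [exact: openT | apply/seteqP; split].
rewrite (_ : [set y | _] =
    (proj i @^-1` [set z i]) `&` [set y : K -> bool | {in r, z =1 y}]).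
  apply: openI => //; apply: open_comp => [y _|]; last exact: discrete_open.
  exact: (@proj_continuous K (fun=> bool) i).
apply/seteqP; split => [y zy|y [/= yi zy] j].
  by split=> [/=|j qj]; [rewrite /proj zy ?mem_head | rewrite zy// inE qj orbT].
by rewrite inE => /orP[/eqP->|/zy].
Qed.

Lemma cube_compact : compact [set: {ptws K -> bool}].
Proof.
have := @tychonoff K (fun=> bool) (fun=> setT) (fun=> bool_compact).
by congr compact; apply/seteqP.
Qed.

(** Finitely many cylinders inside [O] cover the compact set [D]; [r] concatenates their
    supports. *)
Lemma cube_closed_sat D (O : set {ptws K -> bool}) :
  closed (D : set {ptws K -> bool}) -> open O -> D `<=` O ->
  exists r, sat r D `<=` O.
Proof.
move=> cD oO DO.
have cpD : compact (D : set {ptws K -> bool}).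
  exact: (subclosed_compact cD cube_compact).
have /choice[r rP] : forall x : K -> bool, exists r,
    O x -> forall y : K -> bool, {in r, x =1 y} -> O y.
  move=> x; have [Ox|nOx] := pselect (O x); last by exists [::].
  by have [r ?] := cube_open_cylinder oO Ox; exists r.
have [|E [ED DE]] := compact_finite_subcover
    (U := fun x : {ptws K -> bool} => [set y : K -> bool | {in r x, x =1 y}]) cpD.
  by move=> x _; apply: open_nbhs_nbhs; split; first exact: cylinder_open.
exists (flatten [seq r x | x <- E]) => y [x Dx xy].
have [z /= zE zx] := DE _ Dx.
apply: (rP z); first by apply: DO; exact: ED.
move=> i ri; rewrite zx// xy//; apply/flattenP; exists (r z) => //.
exact: map_f.
Qed.
End CantorCube.

(** * The transfinite construction *)

Section Stages.
Variables (X : topologicalType) (K : choiceType) (f : {ptws K -> bool} -> X).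
Hypotheses (hX : hausdorff_space X) (cX : compact [set: X]).
Hypotheses (cf : continuous f) (sf : forall x, exists k, f k = x).
Implicit Types (S : set K) (r s t : seq K) (w : set (K -> bool)).

Definition traces S : set (set X) :=
  [set U | U !=set0 /\ exists r w,
    [/\ forall i, i \in r -> S i, supported r w & U = (f @` w)°]].

(** Stated with a saturation along [t] rather than an open set, so that only [t] has to be recorded.
    A larger [t] shrinks the saturation and weakens the condition, so the members of a finite cover
    can share one [t]. *)
Definition blocked S t (V : set X) := forall r w,
  (forall i, i \in r -> S i) -> supported r w -> (f @` w)° !=set0 ->
  ~ w `<=` sat t (f @^-1` closure V).

Lemma blockedS S t t' V : {subset t <= t'} -> blocked S t V -> blocked S t' V.
Proof.
move=> tt' bV r w rS rw w0 wV; apply: (bV r w) => // x /wV [y Vy yx].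
by exists y => // i /tt'; exact: yx.
Qed.

Lemma traces_avoid S p : ~ is_local_pi_base p (traces S) ->
  exists O : set X, [/\ open O, O p & forall V, traces S V -> ~ V `<=` O].
Proof.
move=> npi; apply: contrapT => nO; apply: npi.
split=> [V [V0 [r [w [_ _ VE]]]]|U oU Up].
  by split => //; rewrite VE; exact: open_interior.
apply: contrapT => nV; apply: nO; exists U; split => // V tV VU.
by apply: nV; exists V.
Qed.

(** Pick [W] around [p] containing no trace and [V] with closure in [W] and [G]. A suitable [t]
    keeps the saturation inside the preimage of [W], so a violating [w] would give a trace inside
    [W]. *)
Lemma blocked_nbhd A S (G : set X) p : is_base A ->
  ~ is_local_pi_base p (traces S) -> open G -> G p ->
  exists V t, [/\ A V, V p, V `<=` G & blocked S t V].
Proof.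
move=> [Ao Ab] /traces_avoid [W [oW Wp WS]] oG Gp.
have [N [oN Np NWG]] := compact_hausdorff_shrink hX cX (openI oW oG) (conj Wp Gp).
have [V [AV Vp VN]] := Ab N p oN Np.
have clV : closure V `<=` W `&` G := subset_trans (closureS VN) NWG.
have [||x Vx|t tW] := @cube_closed_sat K (f @^-1` closure V) (f @^-1` W).
- by apply: preimage_closed => [x _|]; [exact: cf | exact: closed_closure].
- by apply: open_comp => [x _|//]; exact: cf.
- by have [] := clV _ Vx.
exists V, t; split => // [x /subset_closure /clV []//|r w rS rw w0 wV].
apply: (WS (f @` w)°); first by split => //; exists r, w.
move=> y /interior_subset [x wx <-]; exact/tW/wV.
Qed.

Lemma blocked_cover A S (C G : set X) : is_base A ->
  (forall p, ~ is_local_pi_base p (traces S)) -> open G -> closure C `<=` G ->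
  exists tF : seq K * seq (set X),
    (forall V, V \in tF.2 -> [/\ A V, V !=set0, V `<=` G & blocked S tF.1 V]) /\
    forall x, closure C x -> exists2 V, V \in tF.2 & V x.
Proof.
move=> bA npi oG CG.
have /choice[Vt VtP] : forall p, exists Vt : set X * seq K, closure C p ->
    [/\ A Vt.1, Vt.1 p, Vt.1 `<=` G & blocked S Vt.2 Vt.1].
  move=> p; have [Cp|nCp] := pselect (closure C p); last by exists (set0, [::]).
  by have [V [t ?]] := blocked_nbhd bA (npi p) oG (CG _ Cp); exists (V, t).
have cC : compact (closure C).
  by apply: (subclosed_compact _ cX) => //; exact: closed_closure.
have [p Cp|E [EC CE]] := @compact_finite_subcover _ _ (fun p => (Vt p).1) cC.
  have [AV Vp _ _] := VtP _ Cp.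
  by apply: open_nbhs_nbhs; split=> //; apply: bA.1.
exists (flatten [seq (Vt p).2 | p <- E], [seq (Vt p).1 | p <- E]) => /=.
split=> [V /mapP[p pE ->]|x /CE[p pE Vx]]; last first.
  by exists (Vt p).1 => //; apply/mapP; exists p.
have [AV Vp VG bV] := VtP p (EC _ pE); split => //; first by exists p.
apply: blockedS bV => i it; apply/flattenP; exists (Vt p).2 => //.
by apply/mapP; exists p.
Qed.

Section Recursion.
Variables (A : set (set X)) (I : Type) (lt : I -> I -> Prop) (C G : I -> set X).
Hypotheses (bA : is_base A) (wf : well_founded lt).
Hypothesis total : forall a b, [\/ a = b, lt a b | lt b a].
Hypotheses (oG : forall a, open (G a)) (CG : forall a, closure (C a) `<=` G a).

Definition earlier (T : I -> seq K) a : set K :=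
  [set k | exists2 b, lt b a & k \in T b].

Hypothesis small :
  forall T a p, ~ is_local_pi_base p (traces (earlier T a)).

Lemma stages_exist : exists (T : I -> seq K) (F : I -> seq (set X)), forall a,
  (forall V, V \in F a ->
    [/\ A V, V !=set0, V `<=` G a & blocked (earlier T a) (T a) V]) /\
  forall x, closure (C a) x -> exists2 V, V \in F a & V x.
Proof.
have /choice[g gP] : forall aS : I * set K, exists tF : seq K * seq (set X),
    (forall p, ~ is_local_pi_base p (traces aS.2)) ->
    (forall V, V \in tF.2 -> [/\ A V, V !=set0, V `<=` G aS.1 & blocked aS.2 tF.1 V]) /\
    forall x, closure (C aS.1) x -> exists2 V, V \in tF.2 & V x.
  move=> [a S] /=.
  have [npi|npi] := pselect (forall p, ~ is_local_pi_base p (traces S)).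
    by have [tF ?] := blocked_cover bA npi (oG a) (@CG a); exists tF.
  (* A default value; [small] rules this case out for every set met by the recursion. *)
  by exists ([::], [::]).
pose step a (rec : forall b, lt b a -> seq K * seq (set X)) :=
  g (a, [set k | exists b, exists h : lt b a, k \in (rec b h).1]).
pose E := Fix wf _ step.
have EE a : E a = g (a, earlier (fun b => (E b).1) a).
  rewrite /E Fix_eq => [|b r r' rr']; last first.
    by congr step; apply: functional_extensionality_dep => c;
      apply: functional_extensionality_dep => h; exact: rr'.
  rewrite /step; congr (g (a, _)); apply/seteqP; split=> k [b].
    by move=> [h kb]; exists b.
  by move=> h kb; exists b, h.
exists (fun a => (E a).1), (fun a => (E a).2) => a.
by have := gP (a, _) (@small (fun b => (E b).1) a); rewrite -EE.
Qed.

(* If [U] is contained in a set chosen at stage [a], then interpolation forces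
   the finite support attached to [U] to meet the coordinates which are new at
   stage [a]; every coordinate is new at one stage only. *)
Lemma stages_base : exists A' : set (set X), [/\ A' `<=` A,
  forall a x, closure (C a) x -> exists V, [/\ A' V, V x & V `<=` G a] &
  omega_op_like A'].
Proof.
have [T [F TF]] := stages_exist.
exists [set V | exists a, V \in F a]; split=> [V [a /(TF a).1[]//]|a x Cx|U [b Ub]].
  have [V VF Vx] := (TF a).2 x Cx; exists V; split => //; first by exists a.
  by have [] := (TF a).1 V VF.
have [AU [p Up] _ _] := (TF b).1 U Ub; have oU := bA.1 _ AU.
have [N [oN Np NU]] := compact_hausdorff_shrink hX cX oU Up.
have [||x Nx|s sU] := @cube_closed_sat K (f @^-1` closure N) (f @^-1` U).
- by apply: preimage_closed => [x _|]; [exact: cf | exact: closed_closure].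
- by apply: open_comp => [x _|//]; exact: cf.
- exact: NU.
pose new k := [set V | exists a, [/\ k \in T a, ~ earlier T a k & V \in F a]].
apply: (@sub_finite_set _ _ (\bigcup_(k in [set` s]) new k)) => [V [[a VF] UV]|].
  apply: contrapT => nnew.
  have [_ _ _ bV] := (TF a).1 V VF.
  pose u := sat s (f @^-1` closure N).
  (* The common support for interpolation. If no coordinate of [s] is new at stage [a], all of [r]
     was recorded earlier, and [sat r u] contradicts [bV]. *)
  pose r := [seq k <- s | k \in T a].
  apply: (bV r (sat r u)).
  - move=> k; rewrite mem_filter => /andP[kT ks].
    by apply: contrapT => nk; apply: nnew; exists k => //; exists a.
  - exact: sat_supported.
  - exists p; apply: (filterS _ (open_nbhs_nbhs (conj oN Np))) => y Ny.
    have [x fx] := sf y; exists x => //; apply/sub_sat/sub_sat => /=.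
    by rewrite fx; exact: subset_closure.
  apply: (@sat_interpolation _ s (T a)) => [i si ti|||]; [|exact: sat_supported..|].
    by rewrite mem_filter ti.
  by move=> x /sU Ux; apply: sub_sat; apply: subset_closure; exact: UV.
apply: bigcup_finite => [|k _]; first exact: finite_seq.
(* By totality [k] is new at one stage [a] at most, so [new k] lies in the finite list [F a]. *)
have [[a [ka nka]]|no] := pselect (exists a, k \in T a /\ ~ earlier T a k); last first.
  by apply: (sub_finite_set _ (finite_set0 _)) => V [a [ka nka _]]; apply: no; exists a.
apply: (sub_finite_set _ (finite_seq (F a))) => V [c [kc nkc VF]] /=.
case: (total a c) => [->//|ac|ca]; exfalso.
  by apply: nkc; exists a.
by apply: nka; exists c.
Qed.

End Recursion.
End Stages.

(** * Well-orders and codes *)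

(** Uniqueness of least elements makes [R] antisymmetric; the least of three points gives
    transitivity. *)
Lemma well_order_exists (T : Type) : exists lt : T -> T -> Prop,
  [/\ well_founded lt, forall x y z, lt x y -> lt y z -> lt x z &
      forall x y, [\/ x = y, lt x y | lt y x]].
Proof.
have [R Rwo] := wochoice.well_ordering_principle {classic T}.
have Rmin (A : set T) : A !=set0 -> exists2 z, A z & forall x, A x -> R z x.
  move=> [a Aa]; have [|z [[/asboolP Az zA] _]] := Rwo [pred x | `[< A x >]].
    by exists a; apply/asboolP.
  by exists z => // x Ax; apply: zA; apply/asboolP.
have Ranti x y : R x y -> R y x -> x = y.
  move=> Rxy Ryx.
  have Rxx z : R z z by have [_ -> /(_ z erefl)] := Rmin [set z] (ex_intro _ z erefl).
  have [|z [_ zuniq]] := Rwo [pred u | `[< u = x \/ u = y >]].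
    by exists x; apply/asboolP; left.
  rewrite -(zuniq x); last first.
    by split=> [|u /asboolP[->|->]//]; apply/asboolP; left.
  by apply: zuniq; split=> [|u /asboolP[->|->]//]; apply/asboolP; right.
exists (fun x y => R x y /\ x <> y); split=> [x|x y z [Rxy xy] [Ryz yz]|x y].
- apply: contrapT => nx.
  have [z nz zmin] :=
    Rmin [set z | ~ Acc (fun x y => R x y /\ x <> y) z] (ex_intro _ x nx).
  apply: nz; split => y [Ryz yz]; apply: contrapT => ny.
  by apply: yz; apply: Ranti => //; exact: zmin.
- have [u uxyz umin] := Rmin [set u | [\/ u = x, u = y | u = z]]
    (ex_intro _ x (Or31 _ _ erefl)).
  have uE : u = x.
    case: uxyz => // uE; subst u.
      by case: xy; apply: Ranti => //; apply: umin; exact: Or31.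
    by case: yz; apply: Ranti => //; apply: umin; exact: Or32.
  subst u; split; first by apply: umin; exact: Or33.
  by move=> xz; subst z; apply: xy; exact: Ranti.
- have [->|xy] := pselect (x = y); first exact: Or31.
  have [u [] -> umin] := Rmin [set u | u = x \/ u = y] (ex_intro _ x (or_introl erefl)).
    by apply: Or32; split => //; apply: umin; right.
  by apply: Or33; split; [apply: umin; left | exact: nesym].
Qed.

Lemma lex_well_founded (W I : Type) (ltW : W -> W -> Prop) (ltI : I -> I -> Prop)
    (mu : I -> W) : well_founded ltW -> well_founded ltI ->
  well_founded (fun a b => ltW (mu a) (mu b) \/ mu a = mu b /\ ltI a b).
Proof.
move=> wfW wfI a; move: {2}(mu a) (erefl (mu a)) => m; elim/(well_founded_ind wfW): m a.
move=> m IHm a; elim/(well_founded_ind wfI): a => a IHa am; split => b.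
case=> [|[ba ltba]]; first by rewrite am => /IHm; apply.
by apply: IHa => //; rewrite ba.
Qed.

Lemma ltn_well_founded (I : Type) (h : I -> nat) :
  well_founded (fun a b => (h a < h b)%N).
Proof.
move=> a; move: {2}(h a).+1 (ltnSn (h a)) => n.
elim: n a => [a|n IHn a an]; first by rewrite ltn0.
constructor => b ba; apply: IHn; exact: leq_trans ba an.
Qed.

Lemma inj_on_card_le (T U : Type) (A : set T) (B : set U) (g : T -> U) :
  (forall x, A x -> B (g x)) -> {in A &, injective g} -> A #<= B.
Proof.
move=> gAB /Pinj[h gh]; rewrite -(card_le_eql (card_image h)) -gh.
by apply: subset_card_le => _ [x Ax <-]; exact: gAB.
Qed.

Lemma card_le_inj_on (T U : Type) (A : set T) (B : set U) (u : U) : A #<= B ->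
  exists g : T -> U, (forall x, A x -> B (g x)) /\ {in A &, injective g}.
Proof.
move=> /card_leP[h].
pose g x := if pselect (A x) is left Ax then val (h (SigSub (mem_set Ax))) else u.
exists g; split=> [x Ax|x y /set_mem Ax /set_mem Ay].
  by rewrite /g; case: pselect => // Ax'; exact: set_valP.
rewrite /g; case: pselect => // Ax'; case: pselect => // Ay' /val_inj /(inj _).
by rewrite !inE => /(_ I I) [].
Qed.

Section Code.
Variable W : Type.

(** [CNum] leaves are available over every [D]: they serve as truth values, as positions in a
    sequence, and as room for one extra point. *)
Inductive code := CLeaf of W | CNum of nat | CPair of code & code.

Fixpoint leaves_in (D : set W) (c : code) : Prop :=
  match c with
  | CLeaf x => D x
  | CNum _ => True
  | CPair c d => leaves_in D c /\ leaves_in D d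
  end.

Lemma leaves_inS (D E : set W) : D `<=` E -> leaves_in D `<=` leaves_in E.
Proof. by move=> DE; elim=> //= c IHc d IHd [/IHc ? /IHd]. Qed.

Lemma leaves_in0_countable : countable (leaves_in set0).
Proof.
pose fix g c := match c with
  | CLeaf _ => GenTree.Leaf 0
  | CNum n => GenTree.Leaf n
  | CPair c d => GenTree.Node 0 [:: g c; g d]
  end.
apply: (@card_le_trans _ _ _ [set: GenTree.tree nat]); last exact: countableP.
apply: (inj_on_card_le (g := g)) => // c d /set_mem + /set_mem.
elim: c d => [//|n|c1 IH1 c2 IH2] [//|m|d1 d2] //=; first by move=> _ _ [->].
by move=> [? ?] [? ?] [/IH1 -> // /IH2 ->].
Qed.

Variable lt : W -> W -> Prop.
Hypothesis lt_trans : forall x y z, lt x y -> lt y z -> lt x z.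
Hypothesis lt_total : forall x y, [\/ x = y, lt x y | lt y x].

Definition upto m : set W := [set x | x = m \/ lt x m].

Lemma uptoS m n : upto n m -> upto m `<=` upto n.
Proof. by move=> [->//|mn] x [->|xm]; right => //; exact: lt_trans mn. Qed.

(** Hilbert's hotel: all numbers move up by one and the leaf [m] becomes the number 0. *)
Lemma leaves_in_upto_le m : leaves_in (upto m) #<= leaves_in (lt ^~ m).
Proof.
pose fix g c := match c with
  | CLeaf x => if pselect (x = m) then CNum 0 else CLeaf x
  | CNum n => CNum n.+1
  | CPair c d => CPair (g c) (g d)
  end.
apply: (inj_on_card_le (g := g)).
  elim=> [x /=|//|c IHc d IHd /= [/IHc ? /IHd]//].
  by case: pselect => //= xm [].
move=> c d _ _; elim: c d => [x|n|c1 IH1 c2 IH2] [y|k|d1 d2] //=.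
- case: pselect => xm; case: pselect => ym //=; first by rewrite xm ym.
- by case: pselect.
- by case: pselect.
- by case: pselect.
- by move=> [->].
- by case: pselect.
- by move=> [/IH1 -> /IH2 ->].
Qed.

Lemma leaves_in_bounded (L : set W) c : L !=set0 -> leaves_in L c ->
  exists2 m, L m & leaves_in (upto m) c.
Proof.
move=> [l Ll]; elim: c => [x Lx|n _|c IHc d IHd /= [/IHc[m Lm cm] /IHd[n Ln dn]]].
- by exists x => //; left.
- by exists l.
case: (lt_total m n) => [mn|mn|nm].
- by exists n => //; split => //; rewrite -mn.
- by exists n => //; split => //; apply: leaves_inS cm; apply: uptoS; right.
- by exists m => //; split => //; apply: leaves_inS dn; apply: uptoS; right.
Qed.

End Code.

(** * Counting traces by codes *)

Section Traces.
Variable K : choiceType.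
Implicit Types (r : seq K) (w : set (K -> bool)).

Definition split_at (i : K) (w1 w0 : set (K -> bool)) : set (K -> bool) :=
  [set x | if x i then w1 x else w0 x].

Lemma supported_nil w : supported [::] w -> w = set0 \/ w = setT.
Proof.
move=> sw; have [[x wx]|] := pselect (w !=set0).
  by right; apply/seteqP; split => // y _; apply: sw wx.
by move=> /nonemptyPn ->; left.
Qed.

(** Shannon expansion: [w1] and [w0] are the sections of [w] with coordinate [i] fixed to true and
    to false. *)
Lemma supported_cons i r w : supported (i :: r) w ->
  exists w1 w0, [/\ supported r w1, supported r w0 & w = split_at i w1 w0].
Proof.
move=> sw; pose upd b (x : K -> bool) j := if j == i then b else x j.
have supd b : supported r [set x | w (upd b x)].
  move=> x y xy; apply: sw => j; rewrite inE /upd.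
  by case: eqP => //= _ /xy.
exists [set x | w (upd true x)], [set x | w (upd false x)]; split => //.
have updE x : upd (x i) x = x by apply/funext => j; rewrite /upd; case: eqP => // ->.
by apply/seteqP; split => x; rewrite /split_at /=; have := updE x; case: (x i) => ->.
Qed.

Lemma finite_supported r : finite_set [set w | supported r w].
Proof.
elim: r => [|i r IHr].
  apply: (sub_finite_set _ (finite_set2 set0 setT)) => w /supported_nil.
  by [].
have := finite_image (fun ww => split_at i ww.1 ww.2) (finite_setX IHr IHr).
apply: sub_finite_set => w /supported_cons [w1 [w0 [s1 s0 ->]]].
by exists (w1, w0).
Qed.

Variables (X : topologicalType) (f : {ptws K -> bool} -> X).

Lemma finite_traces (S : set K) : finite_set S -> finite_set (traces f S).
Proof.
move=> /finite_seqP[r SE].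
apply: (sub_finite_set _ (finite_image (fun w => (f @` w)°) (finite_supported r))).
move=> U [_ [s [w [sS sw ->]]]]; exists w => //=.
by apply: supportedS sw => i /sS; rewrite SE.
Qed.

Section Coded.
Variables (W : Type) (D : set W) (dec : code W -> option K).

(* A code is read as a binary decision tree. *)
Fixpoint decision (c : code W) : set (K -> bool) :=
  match c with
  | CNum n.+1 => setT
  | CPair c (CPair d e) =>
      if dec c is Some i then split_at i (decision d) (decision e) else set0
  | _ => set0
  end.

Lemma traces_le_leaves_in (S : set K) :
  (forall i, S i -> exists2 c, leaves_in D c & dec c = Some i) ->
  traces f S #<= leaves_in D.
Proof.
move=> decS.
apply: (card_le_trans _ (card_image_le (fun c => (f @` decision c)°) _)).
apply: subset_card_le => U [_ [r [w [rS sw ->]]]].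
suff [c Dc ->] : exists2 c, leaves_in D c & w = decision c by exists c.
elim: r w rS sw => [w _ /supported_nil[]->|i r IHr w rS /supported_cons].
- by exists (CNum W 0).
- by exists (CNum W 1).
move=> [w1 [w0 [s1 s0 ->]]].
have rS' j : j \in r -> S j by move=> jr; apply: rS; rewrite inE jr orbT.
have [c1 D1 ->] := IHr _ rS' s1; have [c0 D0 ->] := IHr _ rS' s0.
have [c Dc ci] := decS i (rS i (mem_head _ _)).
by exists (CPair c (CPair c1 c0)) => //=; rewrite ci.
Qed.
End Coded.

(** A recorded coordinate is coded by the code of its stage paired with its position there;
    injectivity of [h] lets [dec] recover the stage. *)
Lemma traces_earlier_le (I W : Type) (lt : I -> I -> Prop) (T : I -> seq K) a
    (D : set W) (h : I -> code W) :
  injective h -> (forall b, lt b a -> leaves_in D (h b)) ->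
  traces f (earlier lt T a) #<= leaves_in D.
Proof.
move=> hinj hD.
pose dec (c : code W) : option K := if c is CPair c (CNum n) then
  if pselect (exists b, h b = c) is left P then onth (T (projT1 (cid P))) n else None
  else None.
apply: (traces_le_leaves_in (dec := dec)) => k [b ba kb].
exists (CPair (h b) (CNum W (index k (T b)))); first by split => //; exact: hD.
rewrite /dec; case: pselect => [P|[]]; last by exists b.
rewrite (hinj _ _ (projT2 (cid P))).
by rewrite onthE (nth_map k) ?index_mem// nth_index.
Qed.

End Traces.

(** * The theorem *)

(** The intersection of the finitely many basic sets around [x] is a neighbourhood of [x]; every [y]
    other than [x] is missed by one of them, since points are closed. *)
Lemma finite_base_discrete (X : topologicalType) (B : set (set X)) :
  hausdorff_space X -> is_base B -> finite_set B -> forall x : X, open [set x].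
Proof.
move=> hX [Bo Bb] fB x.
have /finite_seqP[s sE] : finite_set (B `&` [set V | V x]).
  exact: sub_finite_set fB.
have sB V : V \in s -> B V /\ V x by move=> Vs; have : [set` s] V by []; rewrite -sE.
rewrite openE => _ ->.
have ns : nbhs x [set y | forall V, V \in s -> V y].
  elim: s sB {sE} => [_|V s IHs sB]; first by apply: filterS filterT.
  have [BV Vx] := sB V (mem_head _ _).
  have nV : nbhs x V by apply: open_nbhs_nbhs; split => //; exact: Bo.
  have ns : nbhs x [set y | forall U, U \in s -> U y].
    by apply: IHs => U Us; apply: sB; rewrite inE Us orbT.
  apply: filterS (filterI nV ns) => y [Vy sy] U.
  by rewrite inE => /orP[/eqP->|/sy].
apply: filterS ns => y ys; apply: contrapT => /= yx.
have cy : closed [set y] by apply: accessible_closed_set1; exact: hausdorff_accessible.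
have [|V [BV Vx Vy]] := Bb (~` [set y]) x (closed_openC cy); first exact: nesym.
apply: (Vy y) => //; apply: ys.
by have : (B `&` [set V | V x]) V by []; rewrite sE.
Qed.

Lemma discrete_op_base (X : topologicalType) (A : set (set X)) :
  is_base A -> (forall x : X, open [set x]) ->
  exists A' : set (set X), A' `<=` A /\ is_base A' /\ omega_op_like A'.
Proof.
move=> [Ao Ab] o1; exists (range set1); split; [|split; first split].
- move=> _ [x _ <-]; have [V [AV Vx Vx1]] := Ab _ x (o1 x) erefl.
  suff <- : V = [set x] by [].
  by apply/seteqP; split => // _ ->.
- by move=> _ [x _ <-].
- by move=> U x oU Ux; exists [set x]; split => // _ ->.
- move=> _ [x _ <-]; apply: (sub_finite_set _ (finite_set1 [set x])).
  by move=> _ [[y _ <-] /(_ x erefl) /= ->].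
Qed.

Section Dyadic.
Variables (X : topologicalType) (K : choiceType) (f : {ptws K -> bool} -> X).
Hypotheses (hX : hausdorff_space X) (cX : compact [set: X]).
Hypotheses (cf : continuous f) (sf : forall x, exists k, f k = x).
Variables (A B : set (set X)).
Hypotheses (bA : is_base A) (bB : is_base B).
Hypothesis pichar : forall p : X, pichar_eq_weight p.

Definition nested : Type :=
  {CG : set X * set X | [/\ B CG.1, B CG.2 & closure CG.1 `<=` CG.2]}.

(** Here pi-character meets weight: a local pi-base among the traces would yield a base no larger
    than they are. The chosen sets form a base since any [x] in an open [U] admits a nested pair
    with [x] in [C] and [G] inside [U]. *)
Lemma op_base_of_order (lt : nested -> nested -> Prop) :
  well_founded lt -> (forall a b, [\/ a = b, lt a b | lt b a]) ->
  (forall T a (B' : set (set X)), is_base B' -> ~ (B' #<= traces f (earlier lt T a))) ->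
  exists A' : set (set X), A' `<=` A /\ is_base A' /\ omega_op_like A'.
Proof.
move=> wf total small.
have oG (a : nested) : open (sval a).2.
  by case: a => -[C G] /= [_ BG _]; exact: bB.1.
have CG (a : nested) : closure (sval a).1 `<=` (sval a).2 by case: a => -[C G] [].
have small' T a p : ~ is_local_pi_base p (traces f (earlier lt T a)).
  by move=> /(pichar p).1[B' [bB' leB']]; exact: small leB'.
have [A' [A'A A'b A'op]] :=
  stages_base hX cX cf sf bA wf total oG CG small'.
exists A'; split => //; split => //; split=> [V /A'A|U x oU Ux]; first exact: bA.1.
have [G [BG Gx GU]] := bB.2 U x oU Ux.
have [N [oN Nx NG]] := compact_hausdorff_shrink hX cX (bB.1 _ BG) Gx.
have [C [BC Cx CN]] := bB.2 N x oN Nx.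
have CGn : [/\ B (C, G).1, B (C, G).2 & closure (C, G).1 `<=` (C, G).2].
  by split => //=; exact: subset_trans (closureS CN) NG.
have [V [A'V Vx VG]] := A'b (exist _ (C, G) CGn) x (subset_closure Cx).
by exists V; split => //; exact: subset_trans VG GU.
Qed.

(** Stages are enumerated by naturals, so each has finitely many predecessors and finitely many
    earlier traces, too few unless some base is finite. In that case [X] is discrete. *)
Lemma op_base_of_countable : countable B ->
  exists A' : set (set X), A' `<=` A /\ is_base A' /\ omega_op_like A'.
Proof.
move=> /countable_injP[e einj].
have [[B' [bB' fB']]|nfin] :=
    pselect (exists B' : set (set X), is_base B' /\ finite_set B').
  exact: discrete_op_base bA (finite_base_discrete hX bB' fB').
have [h hinj] : exists h : nested -> nat, injective h.
  exists (fun a => choice.pickle (e (sval a).1, e (sval a).2)).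
  move=> [[C G] [BC BG CG]] [[C' G'] [BC' BG' CG']] /(pcan_inj choice.pickleK) [].
  move=> /= /(einj _ _ (mem_set BC) (mem_set BC')) EC.
  move=> /(einj _ _ (mem_set BG) (mem_set BG')) EG.
  by apply: eq_exist; move: EC EG => /= -> ->.
apply: (@op_base_of_order (fun a b => (h a < h b)%N)).
- exact: ltn_well_founded.
- move=> a b; case: (ltngtP (h a) (h b)) => [ab|ba|/hinj ->].
  + exact: Or32.
  + exact: Or33.
  + exact: Or31.
move=> T a B' bB' leB'; apply: nfin; exists B'; split => //.
apply: (card_le_finite leB'); apply: finite_traces.
apply: (@sub_finite_set _ _ (\bigcup_(b in h @^-1` `I_(h a)) [set` T b])).
  by move=> k [b ba kb]; exists b.
apply: bigcup_finite => [|b _]; last exact: finite_seq.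
by apply: finite_preimage => [b b' _ _ /hinj//|]; exact: finite_II.
Qed.

(** Stages are ordered first by a bound [mu a] for the leaves of their codes. Stages before [a] then
    have leaves up to [mu a], so their traces inject into the codes with leaves strictly below
    [mu a], too few for a base. *)
Lemma op_base_of_coded (W : Type) (lt : W -> W -> Prop) (L : set W) :
  well_founded lt -> (forall x y z, lt x y -> lt y z -> lt x z) ->
  (forall x y, [\/ x = y, lt x y | lt y x]) ->
  L !=set0 -> B #<= leaves_in L ->
  (forall m (B' : set (set X)), L m -> is_base B' -> ~ (B' #<= leaves_in (lt ^~ m))) ->
  exists A' : set (set X), A' `<=` A /\ is_base A' /\ omega_op_like A'.
Proof.
move=> wfW trW totW L0 /(card_le_inj_on (CNum W 0))[e [eL einj]] smallL.
pose h (a : nested) := CPair (e (sval a).1) (e (sval a).2).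
have hinj : injective h.
  move=> [[C G] [BC BG CG]] [[C' G'] [BC' BG' CG']] [].
  move=> /= /(einj _ _ (mem_set BC) (mem_set BC')) EC.
  move=> /(einj _ _ (mem_set BG) (mem_set BG')) EG.
  by apply: eq_exist; move: EC EG => /= -> ->.
have /choice[mu muP] : forall a, exists m, L m /\ leaves_in (upto lt m) (h a).
  move=> a; have [|m Lm am] := leaves_in_bounded trW totW (c := h a) L0;
    last by exists m.
  by case: a => -[C G] [BC BG CG]; split; exact: eL.
have [ltI [wfI _ totI]] := well_order_exists nested.
apply: (@op_base_of_order _ (lex_well_founded mu wfW wfI)) => [a b|T a B' bB' leB'].
  case: (totW (mu a) (mu b)) => [mab|ab|ba].
  - case: (totI a b) => [->|ab|ba]; first exact: Or31.
    + by apply: Or32; right.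
    + by apply: Or33; right.
  - by apply: Or32; left.
  - by apply: Or33; left.
apply: (smallL (mu a) B' (muP a).1 bB').
apply: card_le_trans (leaves_in_upto_le _ _); apply: card_le_trans leB' _.
apply: traces_earlier_le hinj _ => b ba; apply: leaves_inS (muP b).2.
by apply: uptoS => //; case: ba => [|[->]]; [right|left].
Qed.

End Dyadic.

Theorem theorem3p26 (X : topologicalType) :
  dyadic_compactum X ->
  (forall p : X, pichar_eq_weight p) ->
  forall A : set (set X), is_base A ->
    exists A' : set (set X), A' `<=` A /\ is_base A' /\ omega_op_like A'.
Proof.
move=> [hX [cX [K0 [f0 [cf0 sf0]]]]] pichar A bA.
pose K : choiceType := {classic K0}.
pose f : {ptws K -> bool} -> X := f0.
have cf : continuous f := cf0.
have sf : forall x, exists k, f k = x := sf0.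
have [lt [wf tr tot]] := well_order_exists (set X).
(* [L] stands in for the weight: below each of its points there are too few codes for a base. *)
pose L := [set m | forall B : set (set X), is_base B -> ~ (B #<= leaves_in (lt ^~ m))].
have [B [bB BL]] : exists B : set (set X), is_base B /\ B #<= leaves_in L.
  have [LT|/existsNP[m]] := pselect (forall m, L m).
    exists A; split => //.
    by apply: (inj_on_card_le (g := @CLeaf _)) => [V _|V V' _ _ []//]; exact: LT.
  (* Descent to the least [m] outside [L]: all points below it lie in [L], and codes over them
     suffice for some base. *)
  elim/(well_founded_ind wf): m => m IHm nLm.
  have [ltL|/existsNP[n /not_implyP[/IHm]]//] := pselect (forall n, lt n m -> L n).
  have /existsNP[B /not_implyP[bB /contrapT BL]] := nLm.
  by exists B; split => //; apply: card_le_trans BL (subset_card_le (leaves_inS ltL)).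
have [L0|L0] := pselect (L !=set0).
  apply: (op_base_of_coded hX cX cf sf bA bB pichar wf tr tot L0 BL).
  by move=> m B' Lm; exact: Lm.
(* With [L] empty, only number leaves remain, so [B] is countable. *)
apply: (op_base_of_countable hX cX cf sf bA bB pichar).
apply: sub_countable BL _; move/nonemptyPn: L0 => ->; exact: leaves_in0_countable.
Qed.
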